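(* Let $v$ be an integer with $v \geq 7$ if $v$ is odd, and $v \geq 4$ if $v$ is even. If there exists a $\mathrm{TTS}(v)$ with a Hamiltonian $2$-BIG, then there exists a $\mathrm{TTS}(2v+1)$ with a Hamiltonian $2$-BIG.
   Context: A twofold triple system of order $v$, denoted $\mathrm{TTS}(v)$, is a pair $(V,\mathcal{B})$ where $V$ is a set of $v$ points and $\mathcal{B}$ is a collection of $3$-element subsets of $V$ (called blocks or triples; repeated blocks are permitted, i.e. $\mathcal{B}$ is a multiset) such that each $2$-element subset of $V$ is contained in exactly two blocks of $\mathcal{B}$, counted with multiplicity. The $2$-block-intersection graph ($2$-BIG) of $(V,\mathcal{B})$ is the graph whose vertices are the blocks in $\mathcal{B}$ (repeated blocks giving distinct vertices), where two vertices $B_1,B_2$ are adjacent if and only if $|B_1\cap B_2|=2$. A graph is Hamiltonian if it contains a Hamilton cycle (a cycle, of length at least $3$, through all vertices). *)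

(* Defs.v *)
From mathcomp Require Import all_boot.

Set Implicit Arguments.
Unset Strict Implicit.
Unset Printing Implicit Defensive.

(* The block multiset is a sequence of sets: a repeated block occurs at
   several positions, and [count] counts it with multiplicity. *)
Definition is_TTS (V : finType) (B : seq {set V}) (v : nat) : Prop :=
  [/\ #|V| = v,
      forall b : {set V}, b \in B -> #|b| = 3
    & forall e : {set V}, #|e| = 2 -> count (fun b : {set V} => e \subset b) B = 2].

(* The vertices are the positions in B, so that repeated blocks give distinct
   vertices. *)
Definition two_BIG (V : finType) (B : seq {set V}) : rel 'I_(size B) :=
  fun i j => #|nth set0 B i :&: nth set0 B j| == 2.

Lemma two_BIG_sym (V : finType) (B : seq {set V}) : symmetric (two_BIG (B := B)).
Proof. by move=> i j; rewrite /two_BIG setIC. Qed.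

Lemma two_BIG_irr (V : finType) (B : seq {set V}) (v : nat) :
  is_TTS B v -> irreflexive (two_BIG (B := B)).
Proof. by case=> _ B3 _ i; rewrite /two_BIG setIid B3 ?mem_nth. Qed.

(* For a simple graph given by its adjacency relation e. *)
Definition hamiltonian (T : finType) (e : rel T) : Prop :=
  exists c : seq T, [/\ 3 <= size c, ucycle e c & forall x : T, x \in c].

Definition exists_hamiltonian_TTS (v : nat) : Prop :=
  exists (V : finType) (B : seq {set V}),
    is_TTS B v /\ hamiltonian (two_BIG (B := B)).

(* Main.v *)
Require Import Defs.
From mathcomp Require Import all_boot zify ring.

Set Implicit Arguments.
Unset Strict Implicit.
Unset Printing Implicit Defensive.

(** Let [Z] be a set of [v + 1] new points, with a distinguished point [b], and
    let [F_0, ..., F_(v-1)] be Hamilton cycles on [Z] covering each pair twice.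
    Indexing the old points as [w_0, ..., w_(v-1)] and adding the triples
    [w_i p q] with [p q] an edge of [F_i] gives a TTS([2v + 1]); in its 2-BIG the
    old blocks form one component and each [F_i] becomes a cycle. The [F_i] are
    chosen so that the last edge at [b] of [F_i] is the first edge at [b] of
    [F_(i+1)], which lets one walk around all of [F_i] and step to [F_(i+1)].

    To connect the old blocks, take a block [x y z] of the given Hamilton cycle,
    with neighbours through [x y] and [x z], and put [y = w_0], [x = w_1],
    [z = w_(v-1)]. With [a b] the edge common to [F_0] and [F_1], and [b c] the
    one common to [F_(v-2)] and [F_(v-1)], the edge [a c] also lies in [F_0], so
    that the Pasch configuration [xyz, xab, yac, zbc] can be traded for
    [abc, xya, xzb, yzc]. The Hamilton cycle is then
      [xya], [F_1] from [a] to [b], [F_2], ..., [F_(v-2)], [abc],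
      [F_0] from [a] through [b] to [c], [yzc], [F_(v-1)] from [c] to [b], [xzb],
    followed by the old cycle without [xyz].

    For odd [v], [F_i] is the zigzag [b, i, i+2, i-2, i+4, i-4, ..., i+1] modulo
    [v]. For even [v] one inserts a second point at infinity [m = v - 1] into the
    zigzags modulo [m] by subdividing the edge [{s-1, s+1}] of the [s]-th one, for
    [s <> 0]; these edges form a path, which closes up to the extra cycle. *)

(* The [i]-th Hamilton cycle on [{0, ..., v}] is [v, f i 0, ..., f i (v - 1)].
   [K] splits the edges of every cycle into two kinds such that a pair is an
   edge of each kind in at most one cycle. *)
Record hinged_cycles (v : nat) (f : nat -> nat -> nat) : Prop := HingedCycles {
  hc_lt : forall i j, i < v -> j < v -> f i j < v;
  hc_inj : forall i, i < v -> {in gtn v &, injective (f i)};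
  hc_hinge : forall i, i.+1 < v -> f i v.-1 = f i.+1 0;
  hc_twist : f 0 v.-2 = f v.-1 0;
  hc_colour : exists K : bool -> nat -> rel nat,
    [/\ forall k i, symmetric (K k i),
        forall k i i' p q, p != q -> p <= v -> q <= v -> i < v -> i' < v ->
          K k i p q -> K k i' p q -> i = i',
        forall i, i < v -> exists k, K k i v (f i 0),
        forall i, i < v -> exists k, K k i (f i v.-1) v
      & forall i j, i < v -> j.+1 < v -> exists k, K k i (f i j) (f i j.+1)] }.

(** * Explicit hinged families for odd and even [v] *)

Ltac innermost_if := match goal with
  | |- context [if ?c then _ else _] =>
    lazymatch c with context [if _ then _ else _] => fail | _ => constr:(c) end
  end.

(** Conditions are split from the inside out, so each is free of nested conditionals, and
    contradictory branches are discarded at once. *)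
Ltac lia_ifs :=
  tryif (let c := innermost_if in case: (boolP c) => ?) then
    (try (exfalso; lia); lia_ifs) else lia.

(* [s, s + 2, s - 2, s + 4, s - 4, ...] modulo [m]; the residue is taken by one
   subtraction to keep the definition linear. *)
Definition zigzag (m s j : nat) : nat :=
  let t := if odd j then s + j.+1 else if j == 0 then s else s + (m - j) in
  if t < m then t else t - m.

(* Congruence modulo [m], for [x] and [y] smaller than [2 * m]. *)
Definition cong (m x y : nat) : bool := [|| x == y, x == y + m | x + m == y].

(** For odd [v] doubling is injective modulo [v], so the colour of an edge and the sum of its ends
    determine the cycle. *)
Lemma hinged_cycles_odd (v : nat) : odd v -> 5 <= v -> hinged_cycles v (zigzag v).
Proof.
move=> vo v5; split.
- move=> i j; rewrite /zigzag; lia_ifs.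
- move=> i iv j j'; rewrite !inE /zigzag; lia_ifs.
- move=> i iv; rewrite /zigzag; lia_ifs.
- rewrite /zigzag; lia_ifs.
(* The edges of the [i]-th cycle have sum [2 * i] or [2 * i + 2]. *)
pose A i p q := if p == v then q == i else if q == v then p == i
                else cong v (p + q) (2 * i).
(* Wrapping to 0 keeps [2 * nx i] below [2 * v], within the range of [cong]. *)
pose nx i := if i.+1 < v then i.+1 else 0.
exists (fun k i => if k then A i else A (nx i)); split.
- case=> i p q; rewrite /A /cong; lia_ifs.
- case=> i i' p q; rewrite /A /nx /cong; lia_ifs.
- move=> i iv; exists true; rewrite /A /zigzag /=; lia_ifs.
- move=> i iv; exists false; rewrite /A /nx /zigzag /=; lia_ifs.
move=> i j iv jv; exists (odd j); rewrite /A /nx /zigzag /cong.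
lia_ifs.
Qed.

(* With [m = v - 1] as a point at infinity: cycle [i < m - 1] is the zigzag from
   [s = i + 1] with its last edge [{s - 1, s + 1}] subdivided by [m], cycle
   [m - 1] is the zigzag from [0] followed by [m], and cycle [m] runs from [m]
   through [-1, -3, ..., 3, 1]. *)
Definition even_cycles (v i j : nat) : nat :=
  let m := v.-1 in
  if i < m.-1 then
    if j < m.-1 then zigzag m i.+1 j
    else if j == m.-1 then m else if i.+2 < m then i.+2 else 0
  else if i == m.-1 then if j < m then zigzag m 0 j else m
  else if j == 0 then m
  else if 2 * j.-1 < m then m.-1 - 2 * j.-1 else (2 * m).-1 - 2 * j.-1.

Lemma hinged_cycles_even (v : nat) :
  ~~ odd v -> 4 <= v -> hinged_cycles v (even_cycles v).
Proof.
move=> ve v4; split.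
- move=> i j; rewrite /even_cycles /zigzag; lia_ifs.
- move=> i iv j j'; rewrite !inE /even_cycles /zigzag; lia_ifs.
- move=> i iv; rewrite /even_cycles /zigzag; lia_ifs.
- rewrite /even_cycles /zigzag; lia_ifs.
pose m := v.-1.
pose up s := if s.+1 < m then s.+1 else 0.
(* The zigzag of cycle [i < m] starts at [sh i]. *)
pose sh i := if i < m.-1 then i.+1 else 0.
pose gap2 p q := [|| q == p.+2, p == q.+2, q + m == p.+2 | p + m == q.+2].
(* The zigzag edge of sum [2 * sh i] and gap two is the one subdivided when [sh i <> 0]. It passes
   to the extra cycle [m] in the same colour; only the pair of sum 0 stays with cycle [m - 1]. *)
pose A i p q :=
  if i == m then
    if q == m then p == m.-1 else
    [&& p < m, q < m, gap2 p q & ~~ cong m (p + q) 0]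
  else if q == v then if p == m then i == m.-1 else p == sh i
  else if q == m then (p.+1 == sh i) && (sh i != 0)
  else cong m (p + q) (2 * sh i) && ~~ (gap2 p q && (sh i != 0)).
pose B i p q :=
  if i == m then (q == v) && ((p == m) || (p == 1))
  else if q == v then (p == up (sh i)) && (sh i != 0)
  else if q == m then p == up (sh i)
  else cong m (p + q) (2 * up (sh i)).
(* [A] and [B] are only meaningful for [p < q]. *)
pose S (R : rel nat) p q := if p < q then R p q else R q p.
exists (fun k i => S (if k then A i else B i)); split.
- move=> k i p q; rewrite /S; case: ltngtP => // ->; by [].
(* Doubling is injective modulo [m], which is odd. *)
- have half t s s' : s < m -> s' < m ->
    cong m t (2 * s) -> cong m t (2 * s') -> s = s'.
    by rewrite /cong; lia.
  have upm s : up s < m by rewrite /up; lia_ifs.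
  have shm i : sh i < m by rewrite /sh; lia_ifs.
  have up_inj s s' : s < m -> s' < m -> up s = up s' -> s = s'.
    by rewrite /up; lia_ifs.
  have sh_inj i i' : i < m -> i' < m -> sh i = sh i' -> i = i'.
    by rewrite /sh; lia_ifs.
  have AB k i i' p q : p < q -> q <= v -> i < v -> i' < v ->
      (if k then A i else B i) p q -> (if k then A i' else B i') p q -> i = i'.
    have iE i0 : i0 < v -> i0 = m \/ (i0 < m /\ (i0 == m) = false) by lia.
    move=> pq qv /iE[->|[im imF]] /iE[->|[i'm i'mF]] //.
    + rewrite /A /B eqxx i'mF; case: k.
        case: (eqVneq q v) => [->|qv']; first lia_ifs.
        case: (eqVneq q m) => [qm|qm].
          by move=> /eqP->; rewrite /sh; lia_ifs.
        (* A pair of gap two remains in its zigzag only for [sh i' = 0]; its sum is then 0, which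
           the extra cycle excludes. *)
        case/and4P=> _ _ -> c0 /andP[c]; rewrite /= negbK => /eqP e.
        by move: c c0; rewrite e muln0 => ->.
      by rewrite /up /sh; lia_ifs.
    + rewrite /A /B eqxx imF; case: k.
        case: (eqVneq q v) => [->|qv']; first lia_ifs.
        case: (eqVneq q m) => [qm|qm].
          by move=> + /eqP e; rewrite e /sh; lia_ifs.
        case/andP=> c + /and4P[_ _ g c0]; rewrite g /= negbK => /eqP e.
        by move: c c0; rewrite e muln0 => ->.
      by rewrite /up /sh; lia_ifs.
    rewrite /A /B imF i'mF; case: k.
      case: (eqVneq q v) => [_|qv'].
        by case: (eqVneq p m) => [_|_]; [lia|move=> /eqP-> /eqP; apply: sh_inj].
      case: (eqVneq q m) => [_|_].
        by move=> /andP[/eqP e _] /andP[/eqP e' _]; apply: sh_inj; lia.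
      by move=> /andP[c _] /andP[c' _]; apply/sh_inj/(half _ _ _ _ _ c c').
    case: (eqVneq q v) => [_|_].
      by move=> /andP[/eqP-> _] /andP[/eqP e _]; apply/sh_inj/up_inj.
    case: (eqVneq q m) => [_|_]; first by move=> /eqP-> /eqP e; apply/sh_inj/up_inj.
    by move=> c c'; apply/sh_inj/up_inj/(half _ _ _ _ _ c c').
  move=> k i i' p q; rewrite /S neq_ltn => /orP[pq|qp] pv qv iv i'v.
    by rewrite pq; apply: AB.
  by rewrite ltnNge (ltnW qp); apply: AB.
- move=> i iv; exists (i != m); rewrite /S /A /B /even_cycles /zigzag /cong /gap2 /up /sh.
  lia_ifs.
- move=> i iv; exists (i == m.-1); rewrite /S /A /B /even_cycles /zigzag /cong /gap2 /up /sh.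
  lia_ifs.
move=> i j iv jv.
(* With these facts the zigzag values can be generalised before the colours are unfolded. Among the
   edges of sum [2 * s], only the last may have gap two. *)
have zz s j' : s < m -> j'.+1 < m ->
  let p := zigzag m s j' in let q := zigzag m s j'.+1 in
  [/\ p < m, q < m, cong m (p + q) (2 * if odd j' then s else up s)
    & odd j' -> j'.+2 < m -> ~~ gap2 p q].
  move=> sm j'm p q; rewrite /p /q /zigzag /gap2 /up /cong.
  by split; lia_ifs.
case: (ltnP i m.-1) => im; last case: (eqVneq i m.-1) => im'.
- case: (ltnP j.+1 m.-1) => jm.
    case: (@zz i.+1 j); [lia|lia|].
    rewrite /even_cycles -/m im jm (ltnW jm).
    move: (zigzag _ _ _) (zigzag _ _ _) => p q pm qm pq npq.
    exists (odd j); move: pq npq; rewrite /S /A /B /gap2 /cong /sh /up im; lia_ifs.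
  case: (ltnP j.+1 m) => jm'; [exists true|exists false];
  rewrite /S /A /B /even_cycles /zigzag /cong /gap2 /up /sh im -/m /=; lia_ifs.
- case: (ltnP j.+1 m) => jm.
    case: (@zz 0 j); [lia|lia|].
    rewrite /even_cycles -/m im' ltnn eqxx jm (ltnW jm).
    move: (zigzag _ _ _) (zigzag _ _ _) => p q pm qm pq npq.
    exists (odd j); move: pq npq; rewrite /S /A /B /gap2 /cong /sh /up; lia_ifs.
  exists false.
  rewrite /S /A /B /even_cycles /zigzag /cong /gap2 /up /sh -/m; lia_ifs.
exists true.
have -> : i = m by lia.
rewrite /S /A /even_cycles /cong /gap2 -/m; lia_ifs.
Qed.

(** * Counting pairs in triple systems, and Hamilton cycles as orderings of the blocks *)

Definition adj2 (V : finType) : rel {set V} := fun A B => #|A :&: B| == 2.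
Definition covers (V : finType) (p q : V) : pred {set V} :=
  fun b => (p \in b) && (q \in b).

Lemma adj2_mem (V : finType) (x y z : V) (A B : {set V}) :
  #|A| = 3 -> #|B| = 3 -> x != y -> x \in A -> y \in A -> x \in B -> y \in B ->
  z \in A -> z \notin B -> adj2 A B.
Proof.
move=> A3 B3 xy xA yA xB yB zA zB; rewrite /adj2 eqn_leq; apply/andP; split.
  rewrite -ltnS -A3; apply: proper_card; apply/properP; split; first exact: subsetIl.
  by exists z; rewrite // inE (negPf zB) andbF.
rewrite -(_ : #|[set x; y]| = 2); last by rewrite cards2 xy.
by apply/subset_leq_card/subsetP => u; rewrite !inE => /orP[]/eqP->; apply/andP.
Qed.

Lemma adj2_sym (V : finType) : symmetric (@adj2 V).
Proof. by move=> A B; rewrite /adj2 setIC. Qed.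

(** Double counting: a triple contains six ordered pairs of distinct points. *)
Lemma sum_covers (V : finType) (B : seq {set V}) :
  (forall b, b \in B -> #|b| = 3) ->
  \sum_(p : V) \sum_(q | q != p) count (covers p q) B = 6 * size B.
Proof.
elim: B => [|b B IH] B3; first by rewrite big1 // => p _; rewrite big1.
transitivity (\sum_(p : V) (\sum_(q | q != p) covers p q b
              + \sum_(q | q != p) count (covers p q) B)).
  by apply: eq_bigr => p _; rewrite -big_split.
rewrite big_split /= IH => [|b' b'B]; last by apply: B3; rewrite inE b'B orbT.
rewrite mulnS; congr (_ + _).
have b3 : #|b| = 3 by apply: B3; rewrite inE eqxx.
transitivity (\sum_(p in b) 2); last by rewrite sum_nat_const b3.
rewrite [RHS]big_mkcond; apply: eq_bigr => p _.
case: (boolP (p \in b)) => pb; last by rewrite big1 // => q _; rewrite /covers (negPf pb).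
have := cardsD1 p b; rewrite b3 pb add1n => -[->].
rewrite -sum1_card big_mkcond [RHS]big_mkcond; apply: eq_bigr => q _.
by rewrite /covers pb !inE; case: eqVneq; case: (q \in b).
Qed.

Lemma count_subset_pair (V : finType) (B : seq {set V}) (p q : V) :
  count (fun b : {set V} => [set p; q] \subset b) B = count (covers p q) B.
Proof. by apply: eq_count => b; rewrite subUset !sub1set. Qed.

Lemma is_TTS_covers (V : finType) (B : seq {set V}) (v : nat) :
  is_TTS B v <-> [/\ #|V| = v, forall b, b \in B -> #|b| = 3
                   & forall p q, p != q -> count (covers p q) B = 2].
Proof.
split=> -[Vv B3 B2]; split=> //.
  by move=> p q pq; rewrite -count_subset_pair B2 // cards2 pq.
by move=> e /eqP/cards2P[p [q [pq ->]]]; rewrite count_subset_pair B2.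
Qed.

Lemma sum_neq_const (V : finType) (c : nat) :
  \sum_(p : V) \sum_(q | q != p) c = c * (#|V| * #|V|.-1).
Proof.
under eq_bigr => p _ do rewrite sum_nat_const cardC1.
by rewrite sum_nat_const mulnA mulnC.
Qed.

Lemma is_TTS_size (V : finType) (B : seq {set V}) (v : nat) :
  is_TTS B v -> 3 * size B = v * v.-1.
Proof.
move=> /is_TTS_covers[Vv B3 B2]; have := sum_covers B3.
under eq_bigr => p _ do under eq_bigr => q qp do rewrite B2 1?eq_sym //.
by rewrite sum_neq_const Vv; lia.
Qed.

(** The number of blocks makes the total of the pair counts as large as the upper bounds allow, so
    each bound is attained. New systems thus need only upper bounds. *)
Lemma is_TTS_of_size (V : finType) (B : seq {set V}) (v : nat) :
  #|V| = v -> (forall b, b \in B -> #|b| = 3) ->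
  (forall p q, p != q -> count (covers p q) B <= 2) ->
  3 * size B = v * v.-1 -> is_TTS B v.
Proof.
move=> Vv B3 B2 Bs; apply/is_TTS_covers; split=> // p0 q0 pq0.
have le p : true -> \sum_(q | q != p) count (covers p q) B <= \sum_(q | q != p) 2
    ?= iff [forall (q | q != p), count (covers p q) B == 2].
  by move=> _; apply: leqif_sum => q qp; apply: leqif_eq; apply: B2; rewrite eq_sym.
have [_] := leqif_sum le; rewrite sum_covers // sum_neq_const Vv.
rewrite (_ : _ == _ = true); last by lia.
move/esym/forall_inP/(_ p0 isT)/forall_inP/(_ q0) => h.
by apply/eqP/h; rewrite eq_sym.
Qed.

Lemma hamiltonian_of_cycle (V : finType) (B : seq {set V}) :
  3 <= size B -> cycle (@adj2 V) B -> hamiltonian (two_BIG (B := B)).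
Proof.
move=> B3 cB; exists (enum 'I_(size B)); split; first by rewrite size_enum_ord.
  rewrite /ucycle enum_uniq andbT.
  have: cycle (@adj2 V) [seq nth set0 B i | i <- map val (enum 'I_(size B))].
    by rewrite val_enum_ord map_nth_iota0 // take_size.
  by rewrite -map_comp cycle_map.
by move=> i; rewrite mem_enum.
Qed.

(** A Hamilton cycle visits each position once, so reading off its blocks permutes [B]; afterwards
    blocks can be handled without positions. *)
Lemma cycle_of_hamiltonian (V : finType) (B : seq {set V}) :
  hamiltonian (two_BIG (B := B)) ->
  exists2 B0, perm_eq B0 B & (3 <= size B0) /\ cycle (@adj2 V) B0.
Proof.
move=> [c [c3 /andP[cc uc] allc]]; exists [seq nth set0 B (val i) | i <- c]; last first.
  by rewrite size_map cycle_map.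
have pc : perm_eq c (enum 'I_(size B)).
  by apply: uniq_perm => //; [exact: enum_uniq|move=> i; rewrite allc mem_enum].
apply: perm_trans (perm_map _ pc) _.
by rewrite (map_comp (nth set0 B) val) val_enum_ord map_nth_iota0 // take_size.
Qed.

(** * Oriented edges of a cycle cut open at a base point *)

Section CycleEdges.
Variable Z : eqType.
Implicit Types (p q b : Z) (s : seq Z).

Definition cycle_edges b s : seq (Z * Z) := pairmap pair b (rcons s b).
Definition joins p q : pred (Z * Z) :=
  fun e => ((p == e.1) || (p == e.2)) && ((q == e.1) || (q == e.2)).

Lemma pairmapE (T : Type) (g : Z -> Z -> T) p s :
  pairmap g p s = [seq g e.1 e.2 | e <- pairmap pair p s].
Proof. by elim: s p => //= q s IH p; rewrite IH. Qed.

Lemma map_fst_cycle_edges b s : map fst (cycle_edges b s) = b :: s.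
Proof.
rewrite /cycle_edges; move: {1 3}b => p; elim: s p => //= q s IH p.
by rewrite IH.
Qed.

Lemma map_snd_cycle_edges b s : map snd (cycle_edges b s) = rcons s b.
Proof.
rewrite /cycle_edges; move: {1}b => p; elim: s p => //= q s IH p.
by rewrite IH.
Qed.

Lemma size_cycle_edges b s : size (cycle_edges b s) = (size s).+1.
Proof. by rewrite size_pairmap size_rcons. Qed.

(** The sources of the edges form [b :: s] and the targets [rcons s b], both without repetition. *)
Lemma cycle_edges_degree b s p : uniq (b :: s) ->
  count (fun e => (p == e.1) || (p == e.2)) (cycle_edges b s) <= 2.
Proof.
move=> us; apply: (@leq_trans (count_mem p (b :: s) + count_mem p (rcons s b))).
  rewrite -{1}(map_fst_cycle_edges b s) -(map_snd_cycle_edges b s) !count_map.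
  rewrite -count_predUI; apply: leq_trans (leq_addr _ _).
  by apply: sub_count => e /=; rewrite ![p == _]eq_sym.
by rewrite !count_uniq_mem ?rcons_uniq //; do 2!case: (p \in _).
Qed.

(** An edge and its reverse would close the cycle after two steps, but its length is at least
    three. *)
Lemma cycle_edges_oriented b s p q : uniq (b :: s) -> 2 <= size s ->
  (p, q) \in cycle_edges b s -> (q, p) \notin cycle_edges b s.
Proof.
move=> us s2; apply: contraL => /(nthP (b, b))[j]; rewrite size_cycle_edges => jn.
move=> je; apply/negP => /(nthP (b, b))[i]; rewrite size_cycle_edges => ii ie.
have nE k : k < (size s).+1 -> nth (b, b) (cycle_edges b s) k =
    (nth b (b :: s) k, nth b (b :: s) (if k == size s then 0 else k.+1)).
  move=> ks; rewrite (nth_pairmap b) ?size_rcons // -rcons_cons nth_rcons /= ks.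
  by rewrite nth_rcons; case: (ltngtP k (size s)) => //; lia.
move: je ie; rewrite !nE // => -[j1 j2] [i1 i2].
have ui k l : k < (size s).+1 -> l < (size s).+1 ->
  nth b (b :: s) k = nth b (b :: s) l -> k = l.
  by move=> ks ls /eqP; rewrite nth_uniq // => /eqP.
have := ui _ _ jn _ (etrans j1 (esym i2)); have := ui _ _ ii _ (etrans i1 (esym j2)).
by do 2!case: eqP; lia.
Qed.

Lemma count_joins_cycle_edges b s p q : uniq (b :: s) -> 2 <= size s -> p != q ->
  count (joins p q) (cycle_edges b s) <= 1.
Proof.
move=> us s2 pq; have ue : uniq (cycle_edges b s).
  by apply: (@map_uniq _ _ fst); rewrite map_fst_cycle_edges.
apply: (@leq_trans (count (predU (pred1 (p, q)) (pred1 (q, p))) (cycle_edges b s))).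
  apply: sub_count => -[e1 e2] /andP[/= pe qe]; rewrite !xpair_eqE.
  by case/orP: pe qe pq => /eqP<- /orP[]/eqP<-; rewrite ?eqxx ?orbT.
apply: (@leq_trans (count_mem (p, q) (cycle_edges b s)
                    + count_mem (q, p) (cycle_edges b s))).
  by rewrite -count_predUI leq_addr.
rewrite !count_uniq_mem //; case: (boolP ((p, q) \in _)) => [pqe|_].
  by rewrite (negPf (cycle_edges_oriented us s2 pqe)).
by case: (_ \in _).
Qed.

End CycleEdges.

(** * Auxiliary counts and the Pasch trade *)

Lemma count_le1 (T : eqType) (a : pred T) (s : seq T) : uniq s ->
  {in s &, forall x y, a x -> a y -> x = y} -> count a s <= 1.
Proof.
elim: s => //= x s IH /andP[xs us] h.
have IHs : count a s <= 1.
  by apply: IH => // y z ys zs; apply: h; rewrite inE ?ys ?zs orbT.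
case: (boolP (a x)) => // ax; rewrite (_ : count a s = 0) //.
apply/eqP; rewrite -leqn0 leqNgt -has_count; apply/hasPn => y ys.
by apply: contra xs => ay; rewrite (h x y) ?inE ?eqxx ?ys ?orbT.
Qed.

Lemma cards3 (V : finType) (x y z : V) : uniq [:: x; y; z] -> #|[set x; y; z]| = 3.
Proof.
by move=> u; rewrite -[RHS](card_uniqP u); apply: eq_card => t; rewrite !inE orbA.
Qed.

Lemma is_TTS_perm (V : finType) (B B' : seq {set V}) (v : nat) :
  perm_eq B B' -> is_TTS B v -> is_TTS B' v.
Proof.
move=> /[dup] pB /permP cB [Vv B3 B2]; split=> // [b|e e2].
  by rewrite -(perm_mem pB); apply: B3.
by rewrite -cB B2.
Qed.

(** Both quadruples cover, once each, all pairs of the six points except [xc], [yb] and [za]. The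
    points of the removed blocks are ordered as [cone] produces them. *)
Lemma pasch_trade (V : finType) (x y z a b c : V) (R : seq {set V}) (v : nat) :
  uniq [:: x; y; z; a; b; c] ->
  is_TTS ([:: [set x; y; z]; [set x; b; a]; [set y; c; a]; [set z; b; c]] ++ R) v ->
  is_TTS ([:: [set a; b; c]; [set x; y; a]; [set x; z; b]; [set y; z; c]] ++ R) v.
Proof.
move=> u6 /is_TTS_covers[Vv B3 B2].
have [[[xy xz] [xa xb xc]] [[yz ya yb] [yc za zb]] [zc ab ac bc]] :
    [/\ [/\ x != y /\ x != z & [/\ x != a, x != b & x != c]],
     [/\ [/\ y != z, y != a & y != b] & [/\ y != c, z != a & z != b]]
     & [/\ z != c, a != b, a != c & b != c]].
  by move: u6; rewrite /= !inE !negb_or -!andbA => /and5P[? ? ? ? /and5P[? ? ? ?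
    /and5P[? ? ? ? /and4P[? ? ? _]]]].
have uO : all uniq [:: [:: x; y; z]; [:: x; b; a]; [:: y; c; a]; [:: z; b; c]].
  by rewrite /= !inE !negb_or ![b == a]eq_sym ![c == a]eq_sym; do !(apply/andP; split).
have uN : all uniq [:: [:: a; b; c]; [:: x; y; a]; [:: x; z; b]; [:: y; z; c]].
  by rewrite /= !inE !negb_or; do !(apply/andP; split).
case/and5P: uO => O1 O2 O3 O4 _; case/and5P: uN => N1 N2 N3 N4 _.
apply/is_TTS_covers; split=> // [t|u w uw].
  rewrite mem_cat => /orP[|tR]; last by apply: B3; rewrite mem_cat tR orbT.
  by rewrite !inE => /or4P[]/eqP->; apply: cards3.
rewrite -(B2 u w uw) !count_cat; congr (_ + _).
have m3 p q r t : uniq [:: p; q; r] ->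
    (t \in [set p; q; r] : nat) = (t == p) + (t == q) + (t == r).
  rewrite /= !inE !negb_or => /and3P[/andP[pq pr] qr _].
  case: (eqVneq t p) => [->|_]; first by rewrite (negPf pq) (negPf pr).
  by case: (eqVneq t q) => [->|_]; rewrite ?(negPf qr).
have C t : (covers u w t : nat) = (u \in t) * (w \in t) by rewrite mulnb.
rewrite /= !C !m3 //.
(* Each point lies in two blocks on either side, so the two counts agree as
   polynomials in the indicators, diagonal terms included. *)
move: (u == x : nat) (u == y : nat) (u == z : nat)
      (u == a : nat) (u == b : nat) (u == c : nat).
move: (w == x : nat) (w == y : nat) (w == z : nat)
      (w == a : nat) (w == b : nat) (w == c : nat).
by clear=> *; ring.
Qed.

(** * Cones over cycles and the doubled system *)

Section Doubling.
Variables (V Z : finType) (b : Z).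
Notation W := (V + Z)%type.
Implicit Types (w : V) (p q : Z) (s : seq Z) (vs : seq V) (ss : seq (seq Z)).

Definition lift_block (A : {set V}) : {set W} := [set inl w | w in A].
Definition cone_block w p q : {set W} := [set inl w; inr p; inr q].
Definition cone w s : seq {set W} := pairmap (cone_block w) b (rcons s b).
Definition cones vs ss : seq {set W} := flatten [seq cone e.1 e.2 | e <- zip vs ss].

Lemma inl_lift w A : (inl w \in lift_block A) = (w \in A).
Proof. by rewrite mem_imset // => u u' []. Qed.

Lemma inr_lift p A : (inr p \in lift_block A) = false.
Proof. by apply/imsetP => -[]. Qed.

Lemma inl_cone_block w w' p q : (inl w \in cone_block w' p q) = (w == w').
Proof. by rewrite !inE !orbF. Qed.

Lemma inr_cone_block p w p' q' :
  (inr p \in cone_block w p' q') = (p == p') || (p == q').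
Proof. by rewrite !inE. Qed.

Definition in_blockE := (inl_lift, inr_lift, inl_cone_block, inr_cone_block).

Lemma card_lift (A : {set V}) : #|lift_block A| = #|A|.
Proof. by rewrite card_imset // => u u' []. Qed.

Lemma card_cone_block w p q : p != q -> #|cone_block w p q| = 3.
Proof. by move=> pq; apply: cards3; rewrite /= !inE pq. Qed.

Lemma cone_edges w s :
  cone w s = [seq cone_block w e.1 e.2 | e <- cycle_edges b s].
Proof. exact: pairmapE. Qed.

Lemma size_cones vs ss k : size vs = size ss -> (forall s, s \in ss -> size s = k) ->
  size (cones vs ss) = size vs * k.+1.
Proof.
rewrite /cones; elim: ss vs => [|s ss IH] [|w vs] //= [sv] sk.
rewrite size_cat IH // => [|s' s'ss]; last by rewrite sk // inE s'ss orbT.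
by rewrite cone_edges size_map size_cycle_edges sk ?inE ?eqxx.
Qed.

Lemma cycle_edges_neq s e : uniq (b :: s) -> 0 < size s ->
  e \in cycle_edges b s -> e.1 != e.2.
Proof.
move=> us s0 /(nthP e)[j]; rewrite size_cycle_edges => js <-.
rewrite (nth_pairmap b) ?size_rcons // -rcons_cons nth_rcons /= js nth_rcons.
case: (ltngtP j (size s)) => [jl|jl|->]; last 2 first.
- by move: js; rewrite ltnS leqNgt jl.
- rewrite -last_nth; case: s s0 us {js} => //= p s _ /and3P[/memPn bs _ _].
  by apply: bs; apply: mem_last.
by rewrite -[nth b s j]/(nth b (b :: s) j.+1) nth_uniq //= ?ltnS ?(ltnW jl) // ltn_eqF.
Qed.

Lemma card_cones vs ss A :
  (forall s, s \in ss -> uniq (b :: s) /\ 0 < size s) ->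
  A \in cones vs ss -> #|A| = 3.
Proof.
move=> us /flatten_mapP[[w s] /= ws]; rewrite cone_edges => /mapP[e eb ->].
have [|us' s0] := us s; last by apply/card_cone_block/(cycle_edges_neq us' s0 eb).
elim: (vs) ss ws {us eb} => [|w' vs' IH] [|s' ss] //=.
by rewrite !inE xpair_eqE => /orP[/andP[_ ->]|/IH->]; rewrite ?orbT.
Qed.

Lemma count_cones_inl vs ss w w' : w != w' ->
  count (covers (inl w : W) (inl w')) (cones vs ss) = 0.
Proof.
move=> ww'; apply/eqP; rewrite -leqn0 leqNgt -has_count; apply/hasPn => A.
case/flatten_mapP=> -[u s] _; rewrite cone_edges => /mapP[e _ ->].
rewrite /covers !in_blockE; apply/negP => /andP[/eqP wu /eqP w'u].
by rewrite wu w'u eqxx in ww'.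
Qed.

Lemma count_cones_inlr vs ss w p : uniq vs ->
  (forall s, s \in ss -> uniq (b :: s)) ->
  count (covers (inl w : W) (inr p)) (cones vs ss) <= 2 * (w \in vs).
Proof.
rewrite /cones; elim: vs ss => [|w' vs IH] [|s ss] //= /andP[w'vs uvs] uss.
have uss' t : t \in ss -> uniq (b :: t) by move=> h; apply: uss; rewrite inE h orbT.
rewrite count_cat inE; have := IH ss uvs uss'.
have : count (covers (inl w : W) (inr p)) (cone w' s) <= 2 * (w == w').
  rewrite cone_edges count_map; case: (eqVneq w w') => [<-|ww'].
    have := cycle_edges_degree p (uss s (mem_head _ _)).
    by congr (_ <= _); apply: eq_count => e; rewrite /covers /= !in_blockE eqxx.
  rewrite leqn0 -leqn0 leqNgt -has_count; apply/hasPn => e _.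
  by rewrite /covers /= in_blockE (negPf ww').
by case: (eqVneq w w') => [->|_]; rewrite ?(negPf w'vs) /=; lia.
Qed.

Lemma count_cones_inr vs ss p q : size vs = size ss ->
  count (covers (inr p : W) (inr q)) (cones vs ss)
  = \sum_(s <- ss) count (joins p q) (cycle_edges b s).
Proof.
rewrite /cones; elim: ss vs => [|s ss IH] [|w vs] //=; first by rewrite big_nil.
case=> sv.
rewrite count_cat big_cons IH // cone_edges count_map; congr (_ + _).
by apply: eq_count => e; rewrite /covers /= !in_blockE.
Qed.

Lemma covers_sym (T : finType) (x y : T) : covers x y =1 covers y x.
Proof. by move=> A; rewrite /covers andbC. Qed.

(** Old pairs are covered by [B], mixed pairs are bounded by degrees, new pairs by hypothesis. The
    block count closes the argument: [v * (v - 1) + 3 * v * (v + 1) = (2 * v + 1) * (2 * v)]. *)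
Lemma double_TTS (B : seq {set V}) v vs ss :
  is_TTS B v -> 0 < v -> #|Z| = v.+1 -> uniq vs -> size vs = v -> size ss = v ->
  (forall s, s \in ss -> uniq (b :: s) /\ size s = v) ->
  (forall p q, p != q ->
     \sum_(s <- ss) count (joins p q) (cycle_edges b s) <= 2) ->
  is_TTS (map lift_block B ++ cones vs ss) (2 * v + 1).
Proof.
move=> TB v0 Zv uvs vsv ssv uss ss2; have /is_TTS_covers[Vv B3 B2] := TB.
have lift0 u p : count (covers (u : W) (inr p)) (map lift_block B) = 0.
  apply/eqP; rewrite -leqn0 leqNgt -has_count; apply/hasPn => A /mapP[A' _ ->].
  by rewrite /covers in_blockE andbF.
have vz w p : count (covers (inl w : W) (inr p)) (map lift_block B ++ cones vs ss) <= 2.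
  rewrite count_cat lift0.
  apply: leq_trans (count_cones_inlr w p uvs (fun s h => (uss s h).1)) _.
  by case: (_ \in _).
apply: is_TTS_of_size.
- by rewrite card_sum Vv Zv; lia.
- move=> A; rewrite mem_cat => /orP[/mapP[A' A'B ->]|]; first by rewrite card_lift B3.
  by apply: card_cones => s /uss[us sv]; rewrite sv.
- case=> [w|p] [w'|q] ne.
  + rewrite count_cat count_cones_inl; last by apply: contraNneq ne => ->.
    rewrite addn0 count_map -(B2 w w'); last by apply: contraNneq ne => ->.
    by apply/eq_leq/eq_count => A; rewrite /covers /= !in_blockE.
  + exact: vz.
  + by rewrite (eq_count (covers_sym _ _)); apply: vz.
  rewrite count_cat lift0 count_cones_inr ?ssv //; apply: ss2.
  by apply: contraNneq ne => ->.
rewrite size_cat size_map (size_cones (k := v)) ?vsv ?ssv //; last by move=> s /uss[].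
by rewrite mulnDr (is_TTS_size TB); nia.
Qed.

(** Consecutive edges share a point, so their cones share that point and [w]. The end [p] may equal
    [p1]; the last hypothesis only excludes the walk [p1, p2, p1]. *)
Lemma path_cone_blocks w p1 p2 s p : uniq (p1 :: p2 :: s) -> p \notin p2 :: s ->
  (p != p1) || (s != [::]) ->
  path (@adj2 W) (cone_block w p1 p2) (pairmap (cone_block w) p2 (rcons s p)).
Proof.
have adj q1 q2 q3 : q1 != q2 -> q2 != q3 -> q3 != q1 ->
    adj2 (cone_block w q1 q2) (cone_block w q2 q3).
  move=> n12 n23 n31; apply: (@adj2_mem _ (inl w) (inr q2) (inr q1));
    rewrite ?in_blockE ?card_cone_block ?eqxx ?orbT //.
  by rewrite negb_or n12 eq_sym n31.
elim: s p1 p2 => [|p3 s IH] p1 p2 /=.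
  by rewrite !inE !andbT orbF => n12 n2 n1; rewrite adj // eq_sym.
rewrite !inE !negb_or -!andbA => /and5P[n12 n13 n1s n23 /and3P[n2s n3s us]].
move=> /and3P[np2 np3 nps] _; rewrite adj // 1?eq_sym //=; apply: IH.
- by rewrite /= inE negb_or n23 n2s n3s.
- by rewrite inE negb_or np3.
by rewrite np2.
Qed.

Lemma last_cone_blocks w A p s q :
  last A (pairmap (cone_block w) p (rcons s q)) = cone_block w (last p s) q.
Proof. by rewrite -cats1 pairmap_cat last_cat. Qed.

Definition hinge : rel (seq Z) := fun s s' => last b s == head b s'.

Lemma adj2_hinge w w' p q : w != w' -> p != q ->
  adj2 (cone_block w p q) (cone_block w' q p).
Proof.
move=> ww' pq; apply: (@adj2_mem _ (inr p) (inr q) (inl w)) => //;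
  by rewrite ?in_blockE ?card_cone_block ?eqxx ?orbT // eq_sym.
Qed.

(** The walk enters from the last block of the cone over [s0], since the first block of that cone
    will be traded away. *)
Lemma path_cones w s0 vs ss : uniq (w :: vs) -> size vs = size ss ->
  (forall s, s \in s0 :: ss -> uniq (b :: s) /\ 2 <= size s) -> path hinge s0 ss ->
  let A := cone_block w (last b s0) b in
  path (@adj2 W) A (cones vs ss)
  /\ last A (cones vs ss) = cone_block (last w vs) (last b (last s0 ss)) b.
Proof.
elim: ss vs w s0 => [|s ss IH] [|w' vs] w s0 //= /andP[wvs uvs] [sv] uss.
case/andP=> /eqP hs hss; set A := cone_block _ _ _.
have [us0 s02] := uss s0 (mem_head _ _).
have [|us s2] := uss s; first by rewrite !inE eqxx orbT.
have [|P L] := IH vs w' s uvs sv _ hss.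
  by move=> t tss; apply: uss; rewrite inE tss orbT.
have l0b : last b s0 != b.
  case: s0 us0 s02 {uss hs A} => //= p s1 /andP[/memPn bs _] _.
  by apply: bs; apply: mem_last.
rewrite /cones /= -/(cones vs ss) /cone cat_path last_cat last_cone_blocks L P.
split=> //; rewrite andbT.
case: s us s2 hs {uss IH hss P L} => //= p s us s2 hs.
rewrite /A hs adj2_hinge //=; last 2 first.
- by apply: contraNneq wvs => ->; rewrite mem_head.
- by rewrite -hs.
apply: path_cone_blocks => //; first by case/andP: us.
by case: (s) s2 => //=; rewrite orbT.
Qed.

End Doubling.

(** * Assembly of the new Hamilton cycle *)

Lemma adj2_lift (V Z : finType) (A B : {set V}) :
  adj2 (lift_block Z A) (lift_block Z B) = adj2 A B.
Proof. by rewrite /adj2 -imsetI ?card_lift // => u u' _ _ []. Qed.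

Lemma last_neq (T : eqType) (p q : T) (s : seq T) : p \notin q :: s -> last q s != p.
Proof. by move/memPn; apply; apply: mem_last. Qed.

(** The cone over [F_0] is cut at its traded block [o3] and rotated, so that its last block [y]
    comes first. *)
Lemma perm_doubled_old (T : eqType) (o1 o2 o3 o4 y : T) (X C Y Q L : seq T) :
  perm_eq ((o1 :: L) ++ (Y ++ [:: o3; y]) ++ (o2 :: X) ++ C ++ o4 :: Q)
          ([:: o1; o2; o3; o4] ++ X ++ C ++ (y :: Y) ++ Q ++ L).
Proof. by apply/permP => P; do !rewrite /= ?count_cat; lia. Qed.

Lemma perm_doubled_new (T : eqType) (n1 n2 n3 n4 : T) (X C Y Q L : seq T) :
  perm_eq ([:: n1; n2; n3; n4] ++ X ++ C ++ Y ++ Q ++ L)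
          (n2 :: X ++ C ++ n1 :: Y ++ n4 :: Q ++ n3 :: L).
Proof. by apply/permP => P; do !rewrite /= ?count_cat; lia. Qed.

Lemma sub_doubled_new (T : eqType) (n1 n2 n3 n4 : T) (X C Y Q L : seq T) :
  {subset L <= n2 :: X ++ C ++ n1 :: Y ++ n4 :: Q ++ n3 :: L}.
Proof. by move=> A AL; rewrite !(inE, mem_cat) AL !orbT. Qed.

Lemma cycle_doubled_new (T : Type) (e : rel T) (n1 n2 n3 n4 : T) (X C Y Q L : seq T) :
  path e n2 X -> path e (last n2 X) C -> e (last (last n2 X) C) n1 ->
  path e n1 Y -> e (last n1 Y) n4 -> path e n4 Q -> e (last n4 Q) n3 ->
  path e n3 L -> e (last n3 L) n2 ->
  cycle e (n2 :: X ++ C ++ n1 :: Y ++ n4 :: Q ++ n3 :: L).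
Proof.
move=> pX pC eC pY eY pQ eQ pL eL.
rewrite /= rcons_path !cat_path /= cat_path /= cat_path /= pX pC eC pY eY pQ eQ pL /=.
by rewrite !last_cat /= last_cat /= last_cat.
Qed.

(** The shape of [ss] encodes the shared edges: [F_0] ends in [c, a], [F_1] starts with [a] and
    [F_(v-1)] with [c]. The hinge from [F_0] to [F_1] is thus built in, and the path hypothesis
    starts at [F_1]. *)
Lemma double_hamiltonian (V Z : finType) (v : nat) (S : {set V}) (R : seq {set V})
    (x y z : V) (ws : seq V) (b a c : Z) (t sx sz : seq Z) (ms : seq (seq Z)) :
  let vs := [:: y, x & rcons ws z] in
  let ss := [:: rcons (rcons t c) a, a :: sx & rcons ms (c :: sz)] in
  is_TTS [:: [set x; y; z], S & R] v -> path (@adj2 V) S R ->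
  x \in S -> z \in S -> x \in last S R -> y \in last S R ->
  2 < v -> #|Z| = v.+1 -> uniq vs -> size vs = v -> size ss = v ->
  (forall s, s \in ss -> uniq (b :: s) /\ size s = v) ->
  (forall p q, p != q ->
     \sum_(s <- ss) count (joins p q) (cycle_edges b s) <= 2) ->
  path (hinge b) (a :: sx) (rcons ms (c :: sz)) ->
  exists_hamiltonian_TTS (2 * v + 1).
Proof.
move=> vs ss TB pR xS zS xP yP v2 Zv uvs vsv ssv uss ss2 hss.
have TD := double_TTS TB (ltnW (ltnW v2)) Zv uvs vsv ssv uss ss2.
have [uy sy] := uss _ (mem_head _ _).
have [|ux sxv] := uss (a :: sx); first by rewrite !inE eqxx orbT.
have [|uz szv] := uss (c :: sz); first by rewrite !(inE, mem_rcons) eqxx !orbT.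
have wsms : size ws = size ms.
  by move: vsv; rewrite -ssv /= !size_rcons => -[].
have [yx yz yws [xz xws] [zws uws]] :
  [/\ y != x, y != z, y \notin ws, x != z /\ x \notin ws & z \notin ws /\ uniq ws].
  by move: uvs; rewrite /= inE !mem_rcons !inE rcons_uniq !negb_or -!andbA
    => /and5P[-> -> -> -> /and3P[-> -> ->]].
have [ab [ca ct at_] [bt bc ut]] :
    [/\ a != b, [/\ c != a, c \notin t & a \notin t] & [/\ b \notin t, b != c & uniq t]].
  move: uy; rewrite /= !rcons_uniq !(mem_rcons, inE) !negb_or -!andbA.
  case/and5P=> ba bc bt ac /and3P[at_ ct ut].
  by split; [rewrite eq_sym|split=> //; rewrite eq_sym|].
have xy : x != y by rewrite eq_sym.
have zy : z != y by rewrite eq_sym.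
have ac : a != c by rewrite eq_sym.
have cb : c != b by rewrite eq_sym.
have ba : b != a by rewrite eq_sym.
pose W := (V + Z)%type.
pose pX : {set W} := [set inl x; inl y; inr a].
pose pZ : {set W} := [set inl x; inl z; inr b].
pose pY : {set W} := [set inl y; inl z; inr c].
pose abc : {set W} := [set inr a; inr b; inr c].
(* The cones without their traded blocks: [X] over [F_1] from [a], [Y] over [F_0] from [a] through
   [b] to [c], [Q] over [F_(v-1)] from [c]. *)
pose X : seq {set W} := pairmap (cone_block x) a (rcons sx b).
pose Y : seq {set W} := pairmap (cone_block y) a (b :: rcons t c).
pose Q : seq {set W} := pairmap (cone_block z) c (rcons sz b).
pose C := cones b ws ms.
pose L := map (lift_block Z) (S :: R).
pose B := pX :: X ++ C ++ abc :: Y ++ pY :: Q ++ pZ :: L.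
have TB' : is_TTS B (2 * v + 1).
  apply: is_TTS_perm (perm_doubled_new _ _ _ _ _ _ _ _ _) _.
  apply: pasch_trade.
    rewrite /= !inE; apply/and5P; split; rewrite ?negb_or //; do ?(apply/andP; split=> //).
  have l3 : lift_block Z [set x; y; z] = [set inl x; inl y; inl z].
    by rewrite /lift_block !imsetU !imset_set1.
  rewrite -l3; apply: is_TTS_perm (perm_doubled_old _ _ _ _ _ _ _ _ _ _) _.
  have cE : cones b vs ss =
      cone b y (rcons (rcons t c) a) ++ cone b x (a :: sx) ++ C ++ cone b z (c :: sz).
    rewrite /cones /= -!cats1 zip_cat // map_cat flatten_cat /= cats0.
    by rewrite !cats1.
  have cy : cone b y (rcons (rcons t c) a) =
      pairmap (cone_block y) b (rcons t c) ++ [:: cone_block y c a; cone_block y a b].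
    by rewrite /cone -[rcons (rcons (rcons t c) a) b]cats1 -[rcons (rcons t c) a]cats1
      !pairmap_cat last_cat -catA last_rcons.
  by rewrite cE cy in TD.
exists W, B; split=> //; apply: hamiltonian_of_cycle.
  by have := is_TTS_size TB'; move: (size B) v2; clear=> n; rewrite addn1; nia.
have cpX : #|pX| = 3 by apply: cards3; rewrite /= !inE !negb_or ?xy ?yz ?xz.
have cpY : #|pY| = 3 by apply: cards3; rewrite /= !inE !negb_or ?xy ?yz ?xz.
have cpZ : #|pZ| = 3 by apply: cards3; rewrite /= !inE !negb_or ?xy ?yz ?xz.
have cabc : #|abc| = 3 by apply: cards3; rewrite /= !inE negb_or ab ac bc.
have B3 A : A \in B -> #|A| = 3 by case: TB' => _ + _; apply.
have [PC LC] : path (@adj2 W) (cone_block x (last a sx) b) C /\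
    last (cone_block x (last a sx) b) C
    = cone_block (last x ws) (last b (last (a :: sx) ms)) b.
  apply: (@path_cones V Z b x (a :: sx) ws ms) => //; first by rewrite /= xws.
    move=> s sms; have [|us ->] := uss s; last by rewrite (ltnW v2).
    by move: sms; rewrite !(inE, mem_rcons) => /orP[|] ->; rewrite ?orbT.
  by move: hss; rewrite rcons_path => /andP[].
have lc : last b (last (a :: sx) ms) = c.
  by move: hss; rewrite rcons_path /hinge /= => /andP[_ /eqP].
rewrite lc in LC.
have sx2 : 1 < size sx by rewrite -ltnS -[(size sx).+1]/(size (a :: sx)) sxv.
have sz2 : 1 < size sz by rewrite -ltnS -[(size sz).+1]/(size (c :: sz)) szv.
have PX : path (@adj2 W) pX X.
  rewrite /X; case: (sx) sx2 ux => // p s1 s12 /= /andP[bp us].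
  rewrite path_cone_blocks //; last 2 first.
  - by move: bp; rewrite !inE !negb_or => /and3P[_ -> ->].
  - by rewrite ba.
  rewrite andbT; apply: (@adj2_mem _ (inl x) (inr a) (inl y)) => //;
    rewrite ?in_blockE ?inE ?eqxx ?orbT //.
  by apply: card_cone_block; move: us; rewrite inE negb_or -andbA => /andP[].
have PQ : path (@adj2 W) pY Q.
  rewrite /Q; case: (sz) sz2 uz => // p s1 s12 /= /andP[bp us].
  rewrite path_cone_blocks //; last 2 first.
  - by move: bp; rewrite !inE !negb_or => /and3P[_ -> ->].
  - by rewrite bc.
  rewrite andbT; apply: (@adj2_mem _ (inl z) (inr c) (inl y)) => //;
    rewrite ?in_blockE ?inE ?eqxx ?orbT //.
  by apply: card_cone_block; move: us; rewrite inE negb_or -andbA => /andP[].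
have PY : path (@adj2 W) abc Y.
  rewrite /Y /= path_cone_blocks //; last 3 first.
  - by rewrite /= inE negb_or ab at_ bt.
  - by rewrite inE negb_or cb.
  - by rewrite ca.
  rewrite andbT; apply: (@adj2_mem _ (inr a) (inr b) (inr c)) => //;
    rewrite ?in_blockE ?inE ?eqxx ?orbT // ?card_cone_block //.
  by rewrite negb_or ca.
have PL : path (@adj2 W) pZ L.
  rewrite /L /= path_map (eq_path (e' := @adj2 V)) ?pR ?andbT; last first.
    by move=> A A'; apply: adj2_lift.
  apply: (@adj2_mem _ (inl x) (inl z) (inr b)) => //;
    rewrite ?in_blockE ?inE ?eqxx ?orbT //.
  by rewrite B3 // /B !(inE, mem_cat) eqxx !orbT.
have LL : last pZ L = lift_block Z (last S R) by rewrite /L /= last_map.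
have aLX : adj2 (lift_block Z (last S R)) pX.
  rewrite adj2_sym; apply: (@adj2_mem _ (inl x) (inl y) (inr a)) => //;
    rewrite ?in_blockE ?inE ?eqxx ?orbT //.
  by apply/B3/sub_doubled_new; rewrite -LL /L /= mem_last.
have aCabc : adj2 (cone_block (last x ws) c b) abc.
  by apply: (@adj2_mem _ (inr c) (inr b) (inl (last x ws)));
    rewrite ?in_blockE ?inE ?eqxx ?orbT // card_cone_block.
have bct : c \notin b :: t by rewrite inE negb_or cb.
have aYpY : adj2 (cone_block y (last b t) c) pY.
  have lt := last_neq bct.
  by apply: (@adj2_mem _ (inl y) (inr c) (inr (last b t)));
    rewrite ?in_blockE ?inE ?eqxx ?orbT // card_cone_block.
have aQpZ : adj2 (cone_block z (last c sz) b) pZ.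
  have lt : last c sz != b by apply: last_neq; case/andP: uz.
  by apply: (@adj2_mem _ (inl z) (inr b) (inr (last c sz)));
    rewrite ?in_blockE ?inE ?eqxx ?orbT // card_cone_block.
have LX A : last A X = cone_block x (last a sx) b by apply: last_cone_blocks.
have LQ A : last A Q = cone_block z (last c sz) b by apply: last_cone_blocks.
have LY A : last A Y = cone_block y (last b t) c by apply: last_cone_blocks.
by apply: cycle_doubled_new; rewrite ?LX ?LC ?LY ?LQ ?LL.
Qed.

(** * Hinged families as sequences of points, with [v] as base point *)

Section HingedSequences.
Variables (v : nat) (f : nat -> nat -> nat).
Hypotheses (hf : hinged_cycles v f) (v3 : 3 <= v).
Let b : 'I_v.+1 := ord_max.

Definition cycle_seq (i : nat) : seq 'I_v.+1 := [seq inord (f i j) | j <- iota 0 v].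

Lemma size_cycle_seq i : size (cycle_seq i) = v.
Proof. by rewrite size_map size_iota. Qed.

Lemma val_cycle_seq i j : i < v -> j < v -> (inord (f i j) : 'I_v.+1) = f i j :> nat.
Proof. by move=> iv jv; rewrite inordK // ltnW // ltnS (hc_lt hf). Qed.

Lemma uniq_cycle_seq i : i < v -> uniq (b :: cycle_seq i).
Proof.
move=> iv; rewrite /= map_inj_in_uniq ?iota_uniq ?andbT.
  apply/mapP => -[j]; rewrite mem_iota => /andP[_ jv] /(congr1 val) /=.
  by rewrite val_cycle_seq // => e; have := hc_lt hf iv jv; rewrite -e ltnn.
move=> j j'; rewrite !mem_iota => /andP[_ jv] /andP[_ j'v] /(congr1 val) /=.
by rewrite !val_cycle_seq // => /(hc_inj hf iv); apply.
Qed.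

Lemma nth_cycle_seq i j : j < v -> nth b (cycle_seq i) j = inord (f i j).
Proof. by move=> jv; rewrite (nth_map 0) ?size_iota // nth_iota. Qed.

Lemma hinge_cycle_seq i m : i + m < v ->
  path (hinge b) (cycle_seq i) (map cycle_seq (iota i.+1 m)).
Proof.
elim: m i => //= m IH i im; rewrite IH ?andbT; last by rewrite addSnnS.
rewrite /hinge -nth_last -nth0 size_cycle_seq !nth_cycle_seq; [|lia|lia].
by rewrite (hc_hinge hf) //; lia.
Qed.

(** A cycle has at most one edge joining [p] and [q]. That edge has one of two colours, and each
    colour contains the pair in at most one cycle. *)
Lemma count_joins_cycle_seq (p q : 'I_v.+1) : p != q ->
  \sum_(s <- map cycle_seq (iota 0 v)) count (joins p q) (cycle_edges b s) <= 2.
Proof.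
move=> pq; have [K [Ks Ku K0 Kl Kj]] := hc_colour hf.
have sumK k : \sum_(i <- iota 0 v) (K k i p q : nat) <= 1.
  rewrite (_ : \sum_(i <- _) _ = count (fun i => K k i p q) (iota 0 v)); last first.
    by rewrite -sum1_count [RHS]big_mkcond; apply: eq_bigr => i _; case: (K _ _ _ _).
  apply: count_le1; first exact: iota_uniq.
  move=> i i'; rewrite !mem_iota => /andP[_ iv] /andP[_ i'v].
  by apply: Ku => //; rewrite -ltnS.
rewrite big_map.
apply: (@leq_trans (\sum_(i <- iota 0 v) (K true i p q + K false i p q))); last first.
  by rewrite big_split -[2]/(1 + 1) leq_add.
rewrite big_seq [leqRHS]big_seq; apply: leq_sum => i; rewrite mem_iota => /andP[_ iv].
have ui := uniq_cycle_seq iv.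
have := count_joins_cycle_edges ui _ pq; rewrite size_cycle_seq ltnW // => /(_ isT).
rewrite leq_eqVlt ltnS leqn0 => /orP[/eqP cE|/eqP-> //]; rewrite cE.
have: has (joins p q) (cycle_edges b (cycle_seq i)) by rewrite has_count cE.
case/hasP=> -[e1 e2] eE /andP[/= pe qe].
suff [k Ke]: exists k, K k i e1 e2.
  have {}Ke : K k i p q.
    by case/orP: pe qe pq Ke => /eqP<- /orP[]/eqP<-; rewrite ?eqxx // Ks.
  by case: k Ke => ->; rewrite ?addn1.
case/(nthP (b, b)): eE => j; rewrite size_cycle_edges size_cycle_seq => jv.
rewrite (nth_pairmap b) ?size_rcons ?size_cycle_seq // => -[<- <-].
rewrite -rcons_cons !nth_rcons /= size_cycle_seq jv; case: j jv => [|j] jv /=.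
  have v0 : 0 < v by apply: leq_trans v3.
  rewrite v0 nth_cycle_seq // val_cycle_seq //; exact: K0.
rewrite nth_cycle_seq // val_cycle_seq //; case: (ltngtP j.+1 v) => [jv'|jv'|jv'].
- by rewrite nth_cycle_seq // val_cycle_seq //; apply: Kj.
- by move: jv; rewrite ltnS leqNgt jv'.
by rewrite (_ : j = v.-1); [apply: Kl|rewrite -jv'].
Qed.

End HingedSequences.

(** * Choice of the traded triple, and conclusion *)

Lemma two_pairs_of_triple (V : finType) (T S P : {set V}) :
  #|T| = 3 -> adj2 T S -> adj2 P T -> T :&: S != T :&: P ->
  exists x y z, [/\ uniq [:: x; y; z], T = [set x; y; z], x \in S /\ z \in S
                  & x \in P /\ y \in P].
Proof.
move=> T3 TS PT ne.
have {}TS : #|T :\: S| = 1 by have := cardsID S T; rewrite (eqP TS) T3; lia.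
have {}TP : #|T :\: P| = 1 by have := cardsID P T; rewrite setIC (eqP PT) T3; lia.
(* [y] is the point of [T] missed by [S] and [z] the one missed by [P]. By [ne] they are distinct,
   and [x] is the third point. *)
have [y Sy] := cards1P (introT eqP TS); have [z Pz] := cards1P (introT eqP TP).
have mS u : u \in T -> (u \in S) = (u != y).
  by move=> uT; have := in_set1 u y; rewrite -Sy !inE uT andbT => <-; rewrite negbK.
have mP u : u \in T -> (u \in P) = (u != z).
  by move=> uT; have := in_set1 u z; rewrite -Pz !inE uT andbT => <-; rewrite negbK.
have yT : y \in T by have := set11 y; rewrite -Sy inE => /andP[].
have zT : z \in T by have := set11 z; rewrite -Pz inE => /andP[].
have yz : y != z.
  apply: contraNneq ne => yz; apply/eqP/setP => u; rewrite !inE.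
  by case uT: (u \in T) => //=; rewrite mS // mP // yz.
have : #|T :\ y :\ z| = 1.
  have := cardsD1 y T; have := cardsD1 z (T :\ y).
  by rewrite T3 yT !inE eq_sym yz zT; lia.
case/eqP/cards1P=> x xE; have : x \in [set x] by rewrite set11.
rewrite -xE !inE => /and3P[xz xy xT].
have zy : z != y by rewrite eq_sym.
exists x, y, z; split; rewrite ?mS ?mP //.
  by rewrite /= !inE negb_or xy xz yz.
apply/setP => u; have uE : (u \in T :\ y :\ z) = (u == x) by rewrite xE in_set1.
rewrite !inE -uE !inE.
case: (eqVneq u y) => [->|_]; first by rewrite yT !orbT.
by case: (eqVneq u z) => [->|_] /=; rewrite ?orbF.
Qed.

Theorem theorem3p1 (v : nat) (hv : if odd v then 7 <= v else 4 <= v) :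
  exists_hamiltonian_TTS v -> exists_hamiltonian_TTS (2 * v + 1).
Proof.
have [f hf] : exists f, hinged_cycles v f.
  move: hv; case: (boolP (odd v)) => vo v4.
    by exists (zigzag v); apply: hinged_cycles_odd => //; lia.
  by exists (even_cycles v); apply: hinged_cycles_even.
have {hv} v4 : 4 <= v by case: odd hv; lia.
case=> V [B0 [TB0 /cycle_of_hamiltonian[B pB [B3 cB]]]].
have TB : is_TTS B v by apply: is_TTS_perm TB0; rewrite perm_sym.
case: B B3 cB TB {pB TB0} => [|T [|S R]] //= B3; rewrite rcons_path.
case/and3P=> TS pR PT TB; have /is_TTS_covers[Vv Bc B2] := TB.
have T3 : #|T| = 3 by apply: Bc; rewrite mem_head.
have [|x [y [z [uT TE [xS zS] [xP yP]]]]] := two_pairs_of_triple T3 TS PT.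
  (* If both neighbours met [T] in the same pair, it would lie in three blocks: [T], [S] and
     [last S R]. With at least three blocks, the latter is in [R]. *)
  apply/eqP => e; have /cards2P[p [q [pq TSE]]] := TS.
  have pqm u : u \in [set p; q] -> [/\ u \in T, u \in S & u \in last S R].
    by move=> /[dup]; rewrite -{1}TSE e -TSE !inE => /andP[-> ->] /andP[_ ->].
  have [pT pS pP] := pqm p (set21 _ _); have [qT qS qP] := pqm q (set22 _ _).
  have : has (covers p q) R.
    apply/hasP; exists (last S R); last by rewrite /covers pP.
    by case: (R) B3 => //= A R' _; apply: mem_last.
  have := B2 p q pq; rewrite /= {1 2}/covers pT qT pS qS has_count /=.
  by case: (count _ R).
(* [n] counts the cycles [F_2] to [F_(v-2)]. *)
have [n vE] : exists n, v = n.+3 by case: (v) v4 => [|[|[|n]]] // _; exists n.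
pose ws := enum [pred u | u \notin [:: x; y; z]].
have uvs : uniq [:: y, x & rcons ws z].
  have nws u : u \in [:: x; y; z] -> u \notin ws.
    by move=> h; rewrite mem_enum inE negbK.
  rewrite /= inE !mem_rcons ![_ \in z :: ws]in_cons rcons_uniq enum_uniq !negb_or.
  rewrite !nws ?inE ?eqxx ?orbT // !andbT.
  by move: uT; rewrite /= !inE !negb_or andbT [y == x]eq_sym => /andP[/andP[-> ->] ->].
have vsv : size [:: y, x & rcons ws z] = v.
  rewrite -Vv -(card_uniqP uvs); apply: eq_card => u; rewrite !inE mem_rcons inE mem_enum !inE.
  by do 3!case: eqP => //.
pose b : 'I_v.+1 := ord_max.
pose s := cycle_seq v f.
pose g i j : 'I_v.+1 := inord (f i j).
have iota_last k m : iota k m.+1 = rcons (iota k m) (k + m).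
  by rewrite -addn1 iotaD cats1.
have vI : iota 0 v = iota 0 n.+3 by rewrite vE.
(* The hinge makes [a] the last point of [F_0], and the twist makes [c] the one before it. *)
have f01 : f 0 n.+2 = f 1 0 by rewrite -(hc_hinge hf) vE.
have f0n : f 0 n.+1 = f n.+2 0 by have := hc_twist hf; rewrite vE.
have s0E : s 0 = rcons (rcons [seq g 0 j | j <- iota 0 n.+1] (g n.+2 0)) (g 1 0).
  by rewrite /s /cycle_seq vI !iota_last !map_rcons !add0n f01 f0n.
have sE i : s i = g i 0 :: [seq g i j | j <- iota 1 n.+2].
  by rewrite /s /cycle_seq vI.
have msE : map s (iota 2 n.+1) =
    rcons (map s (iota 2 n)) (g n.+2 0 :: [seq g n.+2 j | j <- iota 1 n.+2]).
  by rewrite iota_last map_rcons sE.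
have ssE : map s (iota 0 v) =
   [:: rcons (rcons [seq g 0 j | j <- iota 0 n.+1] (g n.+2 0)) (g 1 0),
       g 1 0 :: [seq g 1 j | j <- iota 1 n.+2] &
       rcons (map s (iota 2 n)) (g n.+2 0 :: [seq g n.+2 j | j <- iota 1 n.+2])].
  by rewrite -msE -s0E -sE vI.
rewrite TE in TB.
apply: (double_hamiltonian TB pR xS zS xP yP _ (card_ord _) uvs vsv (b := b)
  (a := g 1 0) (c := g n.+2 0) (t := [seq g 0 j | j <- iota 0 n.+1])
  (sx := [seq g 1 j | j <- iota 1 n.+2]) (sz := [seq g n.+2 j | j <- iota 1 n.+2])
  (ms := map s (iota 2 n))); rewrite -?ssE.
- exact: ltnW.
- by rewrite size_map size_iota.
- move=> t /mapP[i]; rewrite mem_iota => /andP[_ iv] ->.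
  by rewrite size_cycle_seq; split=> //; apply: uniq_cycle_seq.
- by move=> p q pq; apply: count_joins_cycle_seq => //; apply: ltnW.
by rewrite -msE -sE; apply: hinge_cycle_seq => //; [apply: ltnW | rewrite vE].
Qed.
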